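(* Let $D_1$ and $D_2$ be simple digraphs with $n_1$ and $n_2$ vertices, respectively. Then (i) $\displaystyle f_{A(D_1\overleftrightarrow{\circ} D_2)}(\lambda) = \big[f_{A(D_2)}(\lambda)\big]^{n_1} f_{A(D_1)}\left(\lambda-\chi_{A(D_2)}(\lambda)\right)$, (ii) $\displaystyle f_{L(D_1\overleftrightarrow{\circ} D_2)}(\lambda) =\big[f_{L(D_2)}(\lambda-1)\big]^{n_1} f_{L(D_1)}\left(\frac{\lambda^2-(n_2+1)\lambda}{\lambda-1}\right)$, (iii) $\displaystyle f_{Q(D_1\overleftrightarrow{\circ} D_2)}(\lambda) =\big[f_{Q(D_2)}(\lambda-1)\big]^{n_1} f_{Q(D_1)}\left(\lambda-n_2-\chi_{Q(D_2)}(\lambda-1)\right)$. In particular, the adjacency (resp. signless Laplacian) spectrum of $D_1\overleftrightarrow{\circ} D_2$ is completely determined by the adjacency (resp. signless Laplacian) characteristic polynomials of $D_1$ and $D_2$ and the $A$-coronal (resp. $Q$-coronal) of $D_2$, whereas the Laplacian spectrum of $D_1\overleftrightarrow{\circ} D_2$ is completely determined by the Laplacian characteristic polynomials of $D_1$ and $D_2$.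
   Context: Digraphs are simple. For a digraph $D$, $A(D)$ is the adjacency matrix, $D_{\rm out}(D)$ the diagonal out-degree matrix, $L(D)=D_{\rm out}(D)-A(D)$ the Laplacian, $Q(D)=D_{\rm out}(D)+A(D)$ the signless Laplacian. $f_M(\lambda)=\det(\lambda I-M)$. For a real $n\times n$ matrix $M$ regarded over $\mathbb{C}(\lambda)$, the $M$-coronal is $\chi_M(\lambda)=\mathbf{1}_n^T(\lambda I_n-M)^{-1}\mathbf{1}_n$ ($\mathbf{1}_n$ the all-ones column vector); the $A$-coronal (resp. $Q$-coronal) of $D$ is $\chi_{A(D)}$ (resp. $\chi_{Q(D)}$). The symmetric-vertex-corona $D_1\overleftrightarrow{\circ} D_2$, where $D_1$ has vertices $v_1,\dots,v_{n_1}$, is obtained by taking one copy of $D_1$ and $n_1$ disjoint copies of $D_2$ and, for each $k$ and each vertex $w$ of the $k$-th copy of $D_2$, adding both arcs $v_kw$ and $wv_k$. *)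

(* Defs.v *)
From HB Require Import structures.
From mathcomp Require Import all_boot all_order all_algebra.
From mathcomp Require Import complex.
From mathcomp Require Import reals.

Set Implicit Arguments.
Unset Strict Implicit.
Unset Printing Implicit Defensive.

Import GRing.Theory.
Local Open Scope ring_scope.

(* A relation has no parallel arcs; opposite arcs are allowed. *)
Record digraph (V : finType) := Digraph {
  arc :> rel V;
  arc_irrefl : irreflexive arc }.

Section Corona.
Variables (V1 V2 : finType) (D1 : digraph V1) (D2 : digraph V2).

(* inr (k, w) is the vertex w of the copy of D2 attached to k. *)
Definition corona_arc : rel (V1 + V1 * V2)%type := fun x y =>
  match x, y with
  | inl u, inl v => D1 u v
  | inl u, inr (k, _) => u == k
  | inr (k, _), inl v => k == v
  | inr (k, w), inr (l, z) => (k == l) && D2 w z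
  end.

Lemma corona_arc_irrefl : irreflexive corona_arc.
Proof. by case=> [u|[k w]] /=; rewrite ?eqxx arc_irrefl. Qed.

Definition sym_vertex_corona := Digraph corona_arc_irrefl.
End Corona.

Section DigraphMatrices.
Variables (R : nzRingType) (V : finType) (D : digraph V).

Definition outdeg (v : V) : nat := #|[set w | D v w]|.

(* Vertices are numbered by enum_val. *)
Definition adjmx : 'M[R]_#|V| :=
  \matrix_(i, j) (D (enum_val i) (enum_val j))%:R.

Definition outdegmx : 'M[R]_#|V| :=
  diag_mx (\row_i (outdeg (enum_val i))%:R).

Definition laplmx : 'M[R]_#|V| := outdegmx - adjmx.

Definition slaplmx : 'M[R]_#|V| := outdegmx + adjmx.
End DigraphMatrices.

Arguments adjmx R {V} D.
Arguments outdegmx R {V} D.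
Arguments laplmx R {V} D.
Arguments slaplmx R {V} D.

Notation ratfun F := {fraction {poly F}}.

Section RationalFunctions.
Variable F : fieldType.
Local Notation ratfun := (ratfun F).

Definition ratconst : F -> ratfun := @FracField.tofrac _ \o polyC.

Definition ratvar : ratfun := FracField.tofrac 'X.

Definition poly_at (p : {poly F}) (x : ratfun) : ratfun :=
  (map_poly ratconst p).[x].

(* The composite r(x).  The value does not depend on the representative of r
   as long as the denominator does not vanish at x, which is always the case
   for nonconstant x. *)
Definition ratfun_at (r x : ratfun) : ratfun :=
  poly_at (\n_(repr r)) x / poly_at (\d_(repr r)) x.

Definition coronal n (M : 'M[F]_n) : ratfun :=
  ((const_mx 1 : 'cV[ratfun]_n)^T
     *m invmx (ratvar%:M - map_mx ratconst M)
     *m (const_mx 1 : 'cV[ratfun]_n)) 0 0.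
End RationalFunctions.

Arguments ratvar F : clear implicits.

(* The eigenvalues with algebraic multiplicity, in an unspecified order: to be
   compared with perm_eq. *)
Definition spectrum (F : closedFieldType) n (M : 'M[F]_n) : seq F :=
  sval (closed_field_poly_normal (char_poly M)).

(* Main.v *)
(* Order the vertices of the corona as V1 followed by V1 x V2.  With N the
   characteristic matrix of D2 shifted by the extra out-degree of its vertices,
   the characteristic matrix of the corona is a block matrix whose lower right
   block is the Kronecker product I (x) N, of determinant (det N)^n1, and whose
   off-diagonal blocks are +-I (x) 1^T and +-I (x) 1.  The Schur complement of
   I (x) N therefore subtracts the scalar 1^T N^-1 1, the coronal of D2, from
   the upper left block, which is the shifted characteristic matrix of D1.  For
   the Laplacian, 1 is an eigenvector of N, so that this scalar is
   n2 / (lambda - 1). *)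
Require Import Defs.
From HB Require Import structures.
From mathcomp Require Import all_boot all_order all_algebra.
From mathcomp Require Import complex.
From mathcomp Require Import reals.
From mathcomp Require Import perm mxtens ring.

Set Implicit Arguments.
Unset Strict Implicit.
Unset Printing Implicit Defensive.

Import GRing.Theory.
Local Open Scope ring_scope.

(** * Determinants of reindexed, Kronecker and block matrices *)

(** Rows and columns undergo the same permutation, so the two signs cancel. Distinct [m] and [n]
    allow for sizes that are equal without being convertible, such as [m] and [m * 1]. *)
Lemma det_mxsub_bij (R : comNzRingType) m n (h : 'I_m -> 'I_n) (A : 'M[R]_n) :
  bijective h -> \det (mxsub h h A) = \det A.
Proof.
move=> h_bij; have m_n : m = n by have := bij_eq_card h_bij; rewrite !card_ord.
case: n / m_n in h A h_bij *.
have -> : mxsub h h A = row_perm (perm (bij_inj h_bij))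
                          (col_perm (perm (bij_inj h_bij)) A).
  by apply/matrixP => i j; rewrite !mxE !permE.
rewrite row_permE col_permE !det_mulmx !det_perm odd_permV mulrC -mulrA.
by rewrite -signr_addb addbb mulr1.
Qed.

Lemma det_reindex (R : comNzRingType) (V : finType) m (h : 'I_m -> V)
    (f : V -> V -> R) :
  bijective h ->
  \det (\matrix_(i, j < #|V|) f (enum_val i) (enum_val j)) =
  \det (\matrix_(i, j < m) f (h i) (h j)).
Proof.
move=> h_bij; have g_bij : bijective (enum_rank \o h).
  by apply: bij_comp => //; apply: enum_rank_bij.
rewrite -(det_mxsub_bij _ g_bij); congr (\det _).
by apply/matrixP => i j; rewrite !mxE /= !enum_rankK.
Qed.

(** Induction on [m]: splitting off the first diagonal block leaves a block diagonal matrix with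
    blocks [A] and [1%:M *t A]. *)
Lemma det_tensmx1l (R : comNzRingType) m n (A : 'M[R]_n) :
  \det ((1%:M : 'M_m) *t A) = \det A ^+ m.
Proof.
elim: m => [|m IHm]; first by rewrite expr0; apply: det_mx00.
rewrite exprS -IHm.
suff -> : (1%:M : 'M_m.+1) *t A = block_mx A 0 0 (1%:M *t A) :> 'M_(n + m * n).
  by rewrite det_ublock.
apply/matrixP => i j.
(* [m.+1 * n] and [n + m * n] are convertible, but not syntactically equal *)
pose T : 'M_(n + m * n) := (1%:M : 'M_m.+1) *t A.
pose idx k : 'I_(n + m * n) := mxtens_index (k : 'I_m.+1 * 'I_n).
have TE k l k' l' : T (idx (k, l)) (idx (k', l')) = (k == k')%:R * A l l'.
  by rewrite [LHS]tensmxE mxE.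
have lshiftE k : lshift (m * n) k = idx (ord0, k) by apply: val_inj.
have rshiftE k l : rshift n (mxtens_index (k, l)) = idx (lift ord0 k, l).
  by apply: val_inj; rewrite /= mulSn addnA.
rewrite -/T; case: (split_ordP i) => {}i ->; case: (split_ordP j) => {}j ->.
- by rewrite block_mxEul !lshiftE TE eqxx mul1r.
- case: (mxtens_indexP j) => k l.
  by rewrite block_mxEur lshiftE rshiftE TE !mxE mul0r.
- case: (mxtens_indexP i) => k l.
  by rewrite block_mxEdl lshiftE rshiftE TE !mxE mul0r.
case: (mxtens_indexP i) (mxtens_indexP j) => k l [k' l'].
by rewrite block_mxEdr !rshiftE TE tensmxE !mxE (inj_eq lift_inj).
Qed.

(** The factor [1%:M : 'M_1] turns the upper left block of the corona into a Kronecker product like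
    the other three; this removes it again. *)
Lemma det_tensmx11 (R : comNzRingType) m (A : 'M[R]_m) :
  \det (A *t (1%:M : 'M_1)) = \det A.
Proof.
have m1 : m = (m * 1)%N by rewrite muln1.
have h_bij : bijective (fun i : 'I_m => mxtens_index (i, ord0 : 'I_1)).
  exists (fun k => (mxtens_unindex k).1) => [i|k]; first by rewrite mxtens_indexK.
  by case: (mxtens_indexP k) => i j; rewrite mxtens_indexK [j]ord1.
rewrite -(det_mxsub_bij _ h_bij); congr (\det _).
by apply/matrixP => i j; rewrite mxE tensmxE mxE mulr1.
Qed.

(** Block elimination: the matrix is a block upper triangular factor, carrying the Schur complement
    of [D], times a block lower triangular one. *)
Lemma det_block_schur (R : comUnitRingType) m n (A : 'M[R]_m) (B : 'M_(m, n))
    (C : 'M_(n, m)) (D : 'M_n) :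
  D \in unitmx ->
  \det (block_mx A B C D) = \det D * \det (A - B *m invmx D *m C).
Proof.
move=> uD.
have -> : block_mx A B C D =
    block_mx (A - B *m invmx D *m C) (B *m invmx D) 0 1%:M *m
    block_mx 1%:M 0 C D.
  rewrite mulmx_block !mulmx1 !mulmx0 !mul1mx !add0r subrK.
  by rewrite -mulmxA mulVmx // mulmx1.
by rewrite det_mulmx det_ublock det_lblock !det1 mulr1 mul1r mulrC.
Qed.

(* [coronal M] is [mxsum (invmx (lam%:M - M))]. *)
Definition mxsum (R : pzSemiRingType) n (M : 'M[R]_n) : R :=
  ((const_mx 1 : 'cV_n)^T *m M *m (const_mx 1 : 'cV_n)) 0 0.

(** By the mixed product rule, the term subtracted in the Schur complement is [b ^+ 2] times the
    scalar [mxsum (invmx B)], so the sign [b] disappears. *)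
Lemma det_corona_block (R : comUnitRingType) m n (A : 'M[R]_m) (B : 'M_n) (b : R) :
  B \in unitmx -> b ^+ 2 = 1 ->
  \det (block_mx (A *t (1%:M : 'M_1)) (b%:M *t (const_mx 1 : 'rV_n))
                 (b%:M *t (const_mx 1 : 'cV_n)) (1%:M *t B)) =
  \det B ^+ m * \det (A - (mxsum (invmx B))%:M).
Proof.
move=> uB b2.
have uIB : (1%:M : 'M_m) *t B \in unitmx.
  by rewrite unitmxE det_tensmx1l unitrX -?unitmxE.
have IBV : invmx ((1%:M : 'M_m) *t B) = 1%:M *t invmx B.
  rewrite -[RHS]mul1mx -(mulVmx uIB) -mulmxA tensmx_mul mulmxV // mulmx1.
  suff -> : (1%:M : 'M[R]_m) *t (1%:M : 'M[R]_n) = 1%:M by rewrite mulmx1.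
  apply/matrixP => i j.
  case: (mxtens_indexP i) (mxtens_indexP j) => i1 i2 [j1 j2].
  rewrite tensmxE !mxE (inj_eq (can_inj (@mxtens_indexK m n))) xpair_eqE.
  by rewrite -natrM mulnb.
rewrite det_block_schur // det_tensmx1l IBV !tensmx_mul !mulmx1.
rewrite -scalar_mxM -expr2 b2 -(det_tensmx11 (A - _)); congr (_ * \det _).
apply/matrixP => i j; case: (mxtens_indexP i) (mxtens_indexP j) => i1 i2 [j1 j2].
rewrite [i2]ord1 [j2]ord1 [LHS]mxE [X in _ + X]mxE !tensmxE -[in LHS]trmx_const.
by rewrite -[X in _ - _ * X]/(mxsum _) !mxE !mulr1 mulr_natl.
Qed.

(** * The characteristic matrix of the corona *)

(* [degadjmx a b] is A for (a, b) = (0, 1), L for (1, -1) and Q for (1, 1). *)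
Section DegreeAdjacency.
Variables (R : comUnitRingType) (a b : R).

Definition degadjmx (V : finType) (D : digraph V) : 'M[R]_#|V| :=
  a *: outdegmx R D + b *: adjmx R D.

(** Each entry becomes a function of two vertices, the form to which [det_reindex] applies. *)
Lemma degadjmx_charE (V : finType) (D : digraph V) (x : R) :
  x%:M - degadjmx D = \matrix_(i, j)
    ((x - a * (outdeg D (enum_val i))%:R) *+ (enum_val i == enum_val j)
     - b * (D (enum_val i) (enum_val j))%:R).
Proof.
apply/matrixP => i j; rewrite !mxE (inj_eq enum_val_inj) opprD addrA.
by case: eqP => _; rewrite ?mulr1n // !mulr0n mulr0 subr0.
Qed.

Variables (V1 V2 : finType) (D1 : digraph V1) (D2 : digraph V2).
Let D := sym_vertex_corona D1 D2.

Lemma outdegE (V : finType) (D0 : digraph V) v :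
  outdeg D0 v = (\sum_w D0 v w)%N.
Proof.
rewrite /outdeg -sum1dep_card big_mkcond /=.
by apply: eq_bigr => w _; case: (D0 v w).
Qed.

Lemma outdeg_corona_base u : outdeg D (inl u) = (outdeg D1 u + #|V2|)%N.
Proof.
rewrite !outdegE big_sumType /=; congr addn.
rewrite (eq_bigr (fun p => (u == p.1) : nat)) => [|[]//].
rewrite -(pair_bigA _ (fun k _ => (u == k) : nat)) /= (bigD1 u) //=.
rewrite eqxx sum_nat_const muln1 [X in (_ + X)%N]big1 ?addn0 // => k.
by rewrite eq_sym => /negPf->; rewrite sum_nat_const muln0.
Qed.

Lemma outdeg_corona_copy k w : outdeg D (inr (k, w)) = (outdeg D2 w).+1.
Proof.
rewrite !outdegE big_sumType /= -add1n; congr addn.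
  by rewrite (bigD1 k) //= eqxx big1 // => u; rewrite eq_sym => /negPf->.
rewrite (eq_bigr (fun p => ((k == p.1) && D2 w p.2) : nat)) => [|[]//].
rewrite -(pair_bigA _ (fun l z => ((k == l) && D2 w z) : nat)) /= (bigD1 k) //=.
rewrite eqxx [X in (_ + X)%N]big1 ?addn0 // => l.
by rewrite eq_sym => /negPf->; rewrite sum_nat_const muln0.
Qed.

(** The corona adds 1 to the out-degree of a copy vertex and [#|V2|] to that of a base vertex,
    whence the shifts of [x] by [a] and by [a * #|V2|%:R]. *)
Lemma det_degadjmx_corona (x : R) :
  b ^+ 2 = 1 ->
  (x - a)%:M - degadjmx D2 \in unitmx ->
  \det (x%:M - degadjmx D) =
  \det ((x - a)%:M - degadjmx D2) ^+ #|V1| *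
  \det ((x - a * #|V2|%:R - mxsum (invmx ((x - a)%:M - degadjmx D2)))%:M
        - degadjmx D1).
Proof.
move=> b2 uN.
(* The ordering of the vertices that exhibits the blocks: the base first, then the copies one after
   the other. *)
pose h (k : 'I_(#|V1| * 1 + #|V1| * #|V2|)) : V1 + V1 * V2 :=
  match split k with
  | inl i => inl (enum_val (mxtens_unindex i).1)
  | inr i => inr (enum_val (mxtens_unindex i).1, enum_val (mxtens_unindex i).2)
  end.
have h_bij : bijective h.
  exists (fun v => match v with
    | inl u => lshift _ (mxtens_index (enum_rank u, ord0))
    | inr (k, w) => rshift _ (mxtens_index (enum_rank k, enum_rank w))
    end) => [k|[u|[k w]]]; rewrite /h.
  - case: split_ordP => i ->; case: (mxtens_indexP i) => p q.
      by rewrite mxtens_indexK /= enum_valK [q]ord1.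
    by rewrite mxtens_indexK /= !enum_valK.
  - by rewrite -[lshift _ _]/(unsplit (inl _)) unsplitK mxtens_indexK /= enum_rankK.
  by rewrite -[rshift _ _]/(unsplit (inr _)) unsplitK mxtens_indexK /= !enum_rankK.
have -> : (x - a * #|V2|%:R - mxsum (invmx ((x - a)%:M - degadjmx D2)))%:M
    - degadjmx D1 = ((x - a * #|V2|%:R)%:M - degadjmx D1)
      - (mxsum (invmx ((x - a)%:M - degadjmx D2)))%:M.
  by rewrite raddfB /= addrAC.
(* The off-diagonal blocks carry [- b], since the adjacency part is subtracted from [x%:M]. *)
rewrite -(det_corona_block _ uN (b := - b)) ?sqrrN //.
rewrite !degadjmx_charE (det_reindex (fun u v =>
  (x - a * (outdeg D u)%:R) *+ (u == v) - b * (D u v)%:R) h_bij).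
congr (\det _); apply/matrixP => i j; rewrite mxE /h.
case: split_ordP => {}i ->; case: split_ordP => {}j ->;
  case: (mxtens_indexP i) (mxtens_indexP j) => i1 i2 [j1 j2];
  rewrite ?(block_mxEul, block_mxEur, block_mxEdl, block_mxEdr) tensmxE !mxE.
- rewrite !mxtens_indexK [i2]ord1 [j2]ord1 eqxx mulr1 outdeg_corona_base.
  by rewrite natrD; congr (_ *+ _ - _); ring.
- rewrite !mxtens_indexK eqE /D /= (inj_eq enum_val_inj).
  by rewrite mulr0n sub0r mulr1 mulr_natr mulNrn.
- rewrite !mxtens_indexK eqE /D /= (inj_eq enum_val_inj).
  by rewrite mulr0n sub0r mulr1 mulr_natr mulNrn.
rewrite !mxtens_indexK outdeg_corona_copy.
rewrite [in X in X - _]eqE /D /= xpair_eqE (inj_eq enum_val_inj).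
(* Between distinct copies both sides vanish; within one copy the added out-degree gives the shift
   by [a]. *)
case: eqP => _; last by rewrite mul0r mulr0n mulr0 subr0.
by rewrite mul1r; congr (_ *+ _ - _); ring.
Qed.

End DegreeAdjacency.

(** * Row sums of the Laplacian and entry sums of inverse matrices *)

Lemma laplmx_const1 (R : nzRingType) (V : finType) (D : digraph V) :
  laplmx R D *m (const_mx 1 : 'cV_#|V|) = 0.
Proof.
apply/colP => i; rewrite mulmxBl mul_diag_mx !mxE mulr1 outdegE natr_sum.
rewrite (reindex (@enum_val V V)) /=; last exact/onW_bij/enum_val_bij.
by apply/eqP; rewrite subr_eq0; apply/eqP/eq_bigr => j _; rewrite !mxE mulr1.
Qed.

Lemma mxsumZ (R : pzSemiRingType) n (c : R) (M : 'M[R]_n) :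
  mxsum (c *: M) = c * mxsum M.
Proof.
rewrite /mxsum trmx_const !mxE mulr_sumr; apply: eq_bigr => i _.
rewrite !mxE !mulr1 mulr_sumr; apply: eq_bigr => j _.
by rewrite !mxE !mul1r.
Qed.

Lemma rmorph_mxsum (R S : nzRingType) (f : {rmorphism R -> S}) n (M : 'M[R]_n) :
  f (mxsum M) = mxsum (map_mx f M).
Proof.
by rewrite /mxsum -(rmorph1 f) -map_const_mx map_trmx -!map_mxM [RHS]mxE.
Qed.

(** Cramer's rule: numerator and denominator are polynomial in the entries of [M], so ring morphisms
    act on each of them. *)
Lemma mxsum_invmx (R : comUnitRingType) n (M : 'M[R]_n) :
  M \in unitmx -> mxsum (invmx M) = mxsum (\adj M) / \det M.
Proof. by move=> uM; rewrite /invmx uM mxsumZ mulrC. Qed.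

(** The inverse maps the all-ones vector to [x^-1] times itself, and the entries of that vector sum
    to [n]. *)
Lemma mxsum_invmx_eigen (K : fieldType) n (M : 'M[K]_n) (x : K) :
  M \in unitmx -> x != 0 ->
  M *m (const_mx 1 : 'cV_n) = x *: const_mx 1 ->
  mxsum (invmx M) = n%:R / x.
Proof.
move=> uM x0 M1.
have Mv1 : invmx M *m (const_mx 1 : 'cV_n) = x^-1 *: const_mx 1.
  by rewrite -[RHS](mulKmx uM) -scalemxAr M1 scalerA mulVf // scale1r.
rewrite /mxsum -mulmxA Mv1 -scalemxAr trmx_const !mxE mulrC; congr (_ / _).
under eq_bigr do rewrite !mxE mulr1.
by rewrite sumr_const card_ord.
Qed.

(** * Substitution of rational functions *)

Section RationalSubstitution.
Variable F : fieldType.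
Local Notation K := (ratfun F).
Local Notation tofrac := (@FracField.tofrac {poly F}).

HB.instance Definition _ := GRing.RMorphism.copy (@ratconst F) (tofrac \o polyC).

(** The argument order makes substitution at a fixed [x] a function of the polynomial, which can
    then be declared a ring morphism. *)
Definition ratsubst (x : K) (p : {poly F}) : K := poly_at p x.

HB.instance Definition _ x := GRing.RMorphism.copy (ratsubst x)
  (horner_eval x \o map_poly (@ratconst F)).

Lemma ratsubst_tofrac (p q : {poly F}) : ratsubst (tofrac q) p = tofrac (p \Po q).
Proof.
rewrite /ratsubst /poly_at /comp_poly -horner_map /=; congr _.[_].
by rewrite -map_poly_comp.
Qed.

Lemma ratsubst_ratvar : ratsubst (ratvar F) =1 tofrac.
Proof. by move=> p; rewrite ratsubst_tofrac comp_polyXr. Qed.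

(** A nonconstant polynomial is transcendental over [F], because composing with it never annihilates
    a nonzero polynomial. *)
Lemma ratsubst_tofrac_neq0 (p q : {poly F}) :
  (1 < size q)%N -> p != 0 -> ratsubst (tofrac q) p != 0.
Proof. by move=> q1 p0; rewrite ratsubst_tofrac tofrac_eq0 comp_poly_eq0. Qed.

(** Determinants and adjugates commute with ring morphisms, so this lets them be evaluated at [x]
    entry by entry. *)
Lemma map_ratsubst_char_poly_mx n (M : 'M[F]_n) x :
  map_mx (ratsubst x) (char_poly_mx M) = x%:M - map_mx (@ratconst F) M.
Proof.
rewrite map_mxB map_scalar_mx /= -map_mx_comp; congr (_%:M - _).
  by rewrite /ratsubst /poly_at map_polyX hornerX.
by apply/matrixP => i j; rewrite !mxE /= /ratsubst /poly_at map_polyC hornerC.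
Qed.

Lemma poly_at_char_poly n (M : 'M[F]_n) x :
  poly_at (char_poly M) x = \det (x%:M - map_mx (@ratconst F) M).
Proof. by rewrite -map_ratsubst_char_poly_mx det_map_mx. Qed.

(** Ties [r] to the chosen representative on which [ratfun_at] is defined. *)
Lemma ratfun_numden (r : K) : r * tofrac \d_(repr r) = tofrac \n_(repr r).
Proof.
rewrite -{1}[r]reprK; unlock FracField.tofrac; rewrite -[LHS]FracField.pi_mul.
apply/eqmodP; rewrite /= FracField.equivfE /FracField.mulf.
by rewrite !numden_Ratio ?oner_neq0 ?mulr1 ?denom_ratioP // mulrC.
Qed.

(* The hypothesis says that [x] is transcendental over [F], so that no denominator
   vanishes at [x]. *)
Lemma ratfun_at_div (p q : {poly F}) (x : K) :
  (forall s, s != 0 -> ratsubst x s != 0) -> q != 0 ->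
  ratfun_at (tofrac p / tofrac q) x = ratsubst x p / ratsubst x q.
Proof.
move=> x_transc q0; set r := _ / _.
rewrite /ratfun_at -!/(ratsubst x _); set d := \d_(repr r); set n := \n_(repr r).
have d0 : d != 0 by apply: denom_ratioP.
(* Cross-multiplication at [x] is the image of an identity between polynomials: both fractions
   represent [r]. *)
apply/eqP; rewrite eqr_div ?x_transc // -!rmorphM; apply/eqP; congr ratsubst.
apply/eqP; rewrite -tofrac_eq !tofracM -ratfun_numden -/d /r.
by rewrite mulrAC divfK ?tofrac_eq0.
Qed.

(** Both the coronal and the right-hand side evaluate one quotient, [p / q] given by Cramer's rule,
    at [ratvar F] and at [x] respectively. *)
Lemma ratfun_at_coronal n (M : 'M[F]_n) (x : K) :
  (forall s, s != 0 -> ratsubst x s != 0) ->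
  ratfun_at (coronal M) x = mxsum (invmx (x%:M - map_mx (@ratconst F) M)).
Proof.
move=> x_transc; set p := mxsum (\adj (char_poly_mx M)); set q := char_poly M.
have q0 : q != 0 by apply/monic_neq0/char_poly_monic.
have mxsumE y : ratsubst y q != 0 ->
    mxsum (invmx (y%:M - map_mx (@ratconst F) M)) = ratsubst y p / ratsubst y q.
  move=> qy0; rewrite -map_ratsubst_char_poly_mx mxsum_invmx.
    by rewrite -map_mx_adj -rmorph_mxsum det_map_mx.
  by rewrite unitmxE det_map_mx unitfE.
have -> : coronal M = tofrac p / tofrac q.
  by rewrite -!ratsubst_ratvar -mxsumE // ratsubst_ratvar tofrac_eq0.
by rewrite mxsumE ?x_transc // ratfun_at_div.
Qed.

End RationalSubstitution.

(** * Characteristic polynomials of the corona *)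

Lemma laplacian_shift (K : fieldType) (x : K) n :
  x - 1 != 0 ->
  x - n%:R - n%:R / (x - 1) = (x ^+ 2 - (n + 1)%:R * x) / (x - 1).
Proof. by move=> x1; field. Qed.

Section CoronaCharPoly.
Variable F : fieldType.
Local Notation lam := (ratvar F).

Lemma ratconst_nat n : ratconst (n%:R : F) = n%:R.
Proof. exact: rmorph_nat. Qed.

Lemma map_degadjmx (a b : F) (V : finType) (D : digraph V) :
  map_mx (@ratconst F) (degadjmx a b D) = degadjmx (ratconst a) (ratconst b) D.
Proof.
apply/matrixP => i j; rewrite !mxE rmorphD !rmorphM rmorphMn /=.
by rewrite !ratconst_nat.
Qed.

Lemma ratvar_sub_transcendental (a : F) (s : {poly F}) :
  s != 0 -> ratsubst (lam - ratconst a) s != 0.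
Proof.
rewrite -[lam - _]tofracB; apply: ratsubst_tofrac_neq0.
by rewrite size_XsubC.
Qed.

(** This is [det_degadjmx_corona] over [ratfun F] at [x = lam]. The copy block is invertible because
    its determinant is a nonzero polynomial evaluated at the transcendental [lam - ratconst a]. *)
Lemma char_poly_corona (a b : F) (V1 V2 : finType)
    (D1 : digraph V1) (D2 : digraph V2) :
  b ^+ 2 = 1 ->
  poly_at (char_poly (degadjmx a b (sym_vertex_corona D1 D2))) lam =
  poly_at (char_poly (degadjmx a b D2)) (lam - ratconst a) ^+ #|V1| *
  poly_at (char_poly (degadjmx a b D1))
    (lam - ratconst a * #|V2|%:R
     - ratfun_at (coronal (degadjmx a b D2)) (lam - ratconst a)).
Proof.
move=> b2; have p0 : char_poly (degadjmx a b D2) != 0.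
  by apply/monic_neq0/char_poly_monic.
have := ratvar_sub_transcendental a p0.
rewrite ratfun_at_coronal; last exact: ratvar_sub_transcendental.
rewrite /ratsubst !poly_at_char_poly !map_degadjmx -unitfE -unitmxE => uN.
by apply: det_degadjmx_corona => //; rewrite -rmorphXn b2 rmorph1.
Qed.

Lemma degadjmx_adjmx (V : finType) (D : digraph V) : degadjmx 0 1 D = adjmx F D.
Proof. by rewrite /degadjmx scale0r add0r scale1r. Qed.

Lemma degadjmx_laplmx (R : comUnitRingType) (V : finType) (D : digraph V) :
  degadjmx 1 (-1) D = laplmx R D.
Proof. by rewrite /degadjmx scale1r scaleN1r. Qed.

Lemma degadjmx_slaplmx (V : finType) (D : digraph V) : degadjmx 1 1 D = slaplmx F D.
Proof. by rewrite /degadjmx !scale1r. Qed.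

(** Rows of the Laplacian sum to 0, so the all-ones vector is an eigenvector of the shifted
    characteristic matrix for [lam - 1]. *)
Lemma coronal_laplmx (V : finType) (D : digraph V) :
  ratfun_at (coronal (laplmx F D)) (lam - 1) = #|V|%:R / (lam - 1).
Proof.
have tr (s : {poly F}) : s != 0 -> ratsubst (lam - 1) s != 0.
  by rewrite -[1](rmorph1 (@ratconst F)); apply: ratvar_sub_transcendental.
have p0 : char_poly (laplmx F D) != 0 by apply/monic_neq0/char_poly_monic.
have := tr _ p0; rewrite ratfun_at_coronal //.
rewrite /ratsubst poly_at_char_poly -degadjmx_laplmx map_degadjmx rmorphN rmorph1.
rewrite degadjmx_laplmx -unitfE -unitmxE => uN.
apply: (mxsum_invmx_eigen uN).
  (* [lam - 1] is nonzero as the value of the polynomial ['X] at a transcendental element. *)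
  have := tr 'X (negbT (polyX_eq0 F)).
  by rewrite /ratsubst /poly_at map_polyX hornerX.
by rewrite mulmxBl laplmx_const1 subr0 mul_scalar_mx.
Qed.

Section Corona.
Variables (V1 V2 : finType) (D1 : digraph V1) (D2 : digraph V2).
Let D := sym_vertex_corona D1 D2.

Lemma char_poly_adjmx_corona :
  poly_at (char_poly (adjmx F D)) lam =
  poly_at (char_poly (adjmx F D2)) lam ^+ #|V1| *
  poly_at (char_poly (adjmx F D1)) (lam - ratfun_at (coronal (adjmx F D2)) lam).
Proof.
have := @char_poly_corona 0 1 _ _ D1 D2 (expr1n _ _).
by rewrite rmorph0 mul0r !subr0 !degadjmx_adjmx.
Qed.

Lemma char_poly_slaplmx_corona :
  poly_at (char_poly (slaplmx F D)) lam =
  poly_at (char_poly (slaplmx F D2)) (lam - 1) ^+ #|V1| *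
  poly_at (char_poly (slaplmx F D1))
    (lam - #|V2|%:R - ratfun_at (coronal (slaplmx F D2)) (lam - 1)).
Proof.
have := @char_poly_corona 1 1 _ _ D1 D2 (expr1n _ _).
by rewrite rmorph1 mul1r !degadjmx_slaplmx.
Qed.

Lemma char_poly_laplmx_corona :
  poly_at (char_poly (laplmx F D)) lam =
  poly_at (char_poly (laplmx F D2)) (lam - 1) ^+ #|V1| *
  poly_at (char_poly (laplmx F D1))
    ((lam ^+ 2 - (#|V2| + 1)%:R * lam) / (lam - 1)).
Proof.
have := @char_poly_corona 1 (-1) _ _ D1 D2; rewrite sqrrN expr1n => /(_ erefl).
rewrite rmorph1 mul1r !degadjmx_laplmx coronal_laplmx => ->.
congr (_ * poly_at _ _); have lam1 : lam - 1 != 0.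
  have := @ratvar_sub_transcendental 1 'X (negbT (polyX_eq0 F)).
  by rewrite /ratsubst /poly_at map_polyX hornerX rmorph1.
exact: laplacian_shift.
Qed.

End Corona.

(** * From characteristic polynomials to spectra *)

Lemma poly_at_ratvar_inj (p q : {poly F}) : poly_at p lam = poly_at q lam -> p = q.
Proof.
rewrite -!/(ratsubst _ _) !ratsubst_ratvar => /eqP.
by rewrite tofrac_eq => /eqP.
Qed.

(** The degree recovers the number of vertices, hence the [n1] and [n2] that occur explicitly in the
    formulas. *)
Lemma char_poly_eq_dim m n (M : 'M[F]_m) (N : 'M[F]_n) :
  char_poly M = char_poly N -> m = n.
Proof.
by move=> /(congr1 (fun p => size (polyseq p))); rewrite !size_char_poly => -[].
Qed.

End CoronaCharPoly.

(** [spectrum] is chosen from the characteristic polynomial alone, so equal polynomials yield the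
    same sequence. *)
Lemma perm_spectrum (F : closedFieldType) m n (M : 'M[F]_m) (N : 'M[F]_n) :
  poly_at (char_poly M) (ratvar F) = poly_at (char_poly N) (ratvar F) ->
  perm_eq (spectrum M) (spectrum N).
Proof. by rewrite /spectrum => /poly_at_ratvar_inj->. Qed.

Theorem theorem3p4 (R : realType) (V1 V2 : finType)
    (D1 : digraph V1) (D2 : digraph V2) :
  let A (V : finType) (D : digraph V) := adjmx R[i] D in
  let L (V : finType) (D : digraph V) := laplmx R[i] D in
  let Q (V : finType) (D : digraph V) := slaplmx R[i] D in
  let n1 := #|V1| in
  let n2 := #|V2| in
  let lam := ratvar R[i] in
  let D := sym_vertex_corona D1 D2 in
  (poly_at (char_poly (A _ D)) lam =
     poly_at (char_poly (A _ D2)) lam ^+ n1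
     * poly_at (char_poly (A _ D1)) (lam - ratfun_at (coronal (A _ D2)) lam))
  /\
  (poly_at (char_poly (L _ D)) lam =
     poly_at (char_poly (L _ D2)) (lam - 1) ^+ n1
     * poly_at (char_poly (L _ D1))
         ((lam ^+ 2 - (n2 + 1)%:R * lam) / (lam - 1)))
  /\
  (poly_at (char_poly (Q _ D)) lam =
     poly_at (char_poly (Q _ D2)) (lam - 1) ^+ n1
     * poly_at (char_poly (Q _ D1))
         (lam - n2%:R - ratfun_at (coronal (Q _ D2)) (lam - 1)))
  /\
  (forall (V1' V2' : finType) (D1' : digraph V1') (D2' : digraph V2'),
     let D' := sym_vertex_corona D1' D2' in
     (char_poly (A _ D1') = char_poly (A _ D1) ->
      char_poly (A _ D2') = char_poly (A _ D2) ->
      coronal (A _ D2') = coronal (A _ D2) ->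
      perm_eq (spectrum (A _ D')) (spectrum (A _ D)))
     /\
     (char_poly (Q _ D1') = char_poly (Q _ D1) ->
      char_poly (Q _ D2') = char_poly (Q _ D2) ->
      coronal (Q _ D2') = coronal (Q _ D2) ->
      perm_eq (spectrum (Q _ D')) (spectrum (Q _ D)))
     /\
     (char_poly (L _ D1') = char_poly (L _ D1) ->
      char_poly (L _ D2') = char_poly (L _ D2) ->
      perm_eq (spectrum (L _ D')) (spectrum (L _ D)))).
Proof.
move=> A L Q n1 n2 lam D.
split; first exact: char_poly_adjmx_corona.
split; first exact: char_poly_laplmx_corona.
split; first exact: char_poly_slaplmx_corona.
move=> V1' V2' D1' D2' D'; split; [|split].
- move=> eq1 eq2 eqc; apply: perm_spectrum; rewrite !char_poly_adjmx_corona.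
  by have dim1 := char_poly_eq_dim eq1; rewrite eq1 eq2 eqc dim1.
- move=> eq1 eq2 eqc; apply: perm_spectrum; rewrite !char_poly_slaplmx_corona.
  have [dim1 dim2] := (char_poly_eq_dim eq1, char_poly_eq_dim eq2).
  by rewrite eq1 eq2 eqc dim1 dim2.
move=> eq1 eq2; apply: perm_spectrum; rewrite !char_poly_laplmx_corona.
have [dim1 dim2] := (char_poly_eq_dim eq1, char_poly_eq_dim eq2).
by rewrite eq1 eq2 dim1 dim2.
Qed.
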